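(* Let $a,b,d$ be three pairwise coprime positive integers and let $m$ be an integer with $b\equiv am\pmod d$. Let $\alpha=\{m/d\}$, $\beta=\{(b-1)/d\}$, $\nu=d\{(a-1)/d\}$ and $C(\alpha,\beta,\nu)=\#\{k\in\{0,\dots,\nu\}: \{k\alpha\}\leqslant\beta\}$. Then $$g\Big(\frac{\langle a,b\rangle}{d}\Big)=\frac{g(\langle a,b\rangle)}{d}+\frac12\big[C(\alpha,\beta,\nu)-1-\beta\nu\big].$$ In particular, if $a\equiv1\pmod d$ or $b\equiv1\pmod d$, then $g(\langle a,b\rangle/d)=\frac{g(\langle a,b\rangle)}{d}=\frac{(a-1)(b-1)}{2d}$.
   Context: $\langle a,b\rangle=\{xa+yb:x,y\in\mathbb{N}\}$; for a numerical semigroup $S$ and positive integer $d$, $S/d=\{x\in\mathbb{N}:dx\in S\}$; $g(S)=\#(\mathbb{N}\setminus S)$ is the genus; $\{x\}$ denotes the fractional part of $x$. *)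

(* Defs.v *)
From mathcomp Require Import all_boot all_order all_algebra finmap.
From mathcomp Require Import boolp classical_sets cardinality zify.

Set Implicit Arguments.
Unset Strict Implicit.
Unset Printing Implicit Defensive.

Import Order.TTheory GRing.Theory Num.Theory.

Local Open Scope classical_set_scope.
Local Open Scope ring_scope.

(* The cardinality of a finite set of naturals; [fset_set] returns the empty
   set on infinite sets, so this is only meaningful when [A] is finite. *)
Definition card_set (A : set nat) : nat := #|` fset_set A|.

Definition gen2 (a b : nat) : set nat :=
  [set n | exists x y : nat, n = (x * a + y * b)%N].

Definition quotient_set (S : set nat) (d : nat) : set nat :=
  [set x | S (d * x)%N].

Definition genus (S : set nat) : nat := card_set (~` S).

Definition frac_part (x : rat) : rat := x - (Num.floor x)%:~R.

(* {0, ..., nu} is read as the set of naturals k <= nu; the parameter nu is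
   a rational so that it can be given as d * {(a - 1) / d}. *)
Definition countC (alpha beta nu : rat) : nat :=
  card_set [set k : nat | k%:R <= nu /\ frac_part (k%:R * alpha) <= beta].

(* Under the coprimality assumption, [genus] and [countC] never meet the junk
   value of [card_set]. *)
Lemma finite_gaps_quotient (a b d : nat) :
  (0 < a)%N -> (0 < b)%N -> (0 < d)%N -> coprime a b ->
  finite_set (~` quotient_set (gen2 a b) d).
Proof.
move=> a0 b0 d0 cab.
apply: (@sub_finite_set _ _ `I_(a * b)); last exact: finite_II.
move=> n /= Hn; rewrite ltnNge; apply/negP => le_n; apply: Hn.
rewrite /quotient_set /gen2 /=.
have {le_n}: (a * b <= d * n)%N by nia.
move: (d * n)%N => N le_N.
pose c := chinese a b 0 N.
have ca : (a %| c)%N by rewrite /dvdn chinese_modl // mod0n.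
have cb : c = N %[mod b] by rewrite chinese_modr.
pose x := ((c %/ a) %% b)%N.
have xb : (x < b)%N by rewrite ltn_mod.
have xaN : (x * a = N %[mod b])%N.
  by rewrite /x -modnMml modn_mod modnMml divnK.
have le_xa : (x * a <= N)%N by nia.
have /dvdnP[y Hy] : (b %| N - x * a)%N by rewrite -eqn_mod_dvd // xaN.
by exists x, y; rewrite -Hy subnKC.
Qed.

Lemma finite_gaps (a b : nat) :
  (0 < a)%N -> (0 < b)%N -> coprime a b -> finite_set (~` gen2 a b).
Proof.
move=> a0 b0 cab; have := @finite_gaps_quotient a b 1 a0 b0 isT cab.
suff -> : quotient_set (gen2 a b) 1 = gen2 a b by [].
by apply/seteqP; split => n; rewrite /quotient_set /= mul1n.
Qed.

Lemma finite_countC (alpha beta nu : rat) :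
  finite_set [set k : nat | k%:R <= nu /\ frac_part (k%:R * alpha) <= beta].
Proof.
apply: (@sub_finite_set _ _ `I_(Num.bound nu)); last exact: finite_II.
move=> k /= [le_k _]; rewrite -(ltr_nat rat).
apply: (le_lt_trans le_k); apply: archi_boundP.
exact: le_trans (ler0n _ _) le_k.
Qed.

(* Main.v *)
(* The gaps of <a, b> are the positive numbers i a - j b with 0 < i < b and
   0 < j < a, each obtained once, and those of <a, b> / d correspond to the
   pairs with i a = j b mod d.  The symmetry (i, j) -> (b - i, a - j) exchanges
   the signs of i a - j b, so twice the genus of the quotient is the number of
   all pairs (i, j) in the rectangle with i = j m mod d.  Dividing b - 1 and
   a - 1 by d with remainders r and nu, all but an r x nu box of the rectangle
   consists of full periods, which are equidistributed, and the box
   contributes C - 1. *)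

Require Import Defs.
From mathcomp Require Import all_boot all_order all_algebra finmap.
From mathcomp Require Import boolp classical_sets cardinality zify ring.

Import GRing.Theory Num.Theory.

(** * Finite cardinalities and congruences modulo [d] *)

Lemma card_set_imset (T : finType) (A : {set T}) (f : T -> nat) :
  {in A &, injective f} ->
  card_set [set n | exists2 p, p \in A & n = f p]%classic = #|A|.
Proof.
move=> f_inj.
have -> : [set n | exists2 p, p \in A & n = f p]%classic =
          [set` [fset f p | p in A]%fset]%classic.
  apply/seteqP; split => n /=.
    by case=> p pA ->; apply/imfsetP; exists p.
  by case/imfsetP => p /= pA ->; exists p.
by rewrite /card_set set_fsetK card_in_imfset // cardE.
Qed.

Lemma eqn_modMr_coprime (k d i j : nat) :
  coprime k d -> (i * k == j * k %[mod d]) = (i == j %[mod d]).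
Proof.
move=> kd; wlog le_ij : i j / j <= i.
  move=> wlg; case/orP: (leq_total j i) => [/wlg //|/wlg E].
  by rewrite eq_sym E eq_sym.
rewrite !eqn_mod_dvd ?leq_mul2r ?le_ij ?orbT // -mulnBl Gauss_dvdl //.
by rewrite coprime_sym.
Qed.

Lemma modn_solve_coprime (k d n : nat) :
  coprime k d -> exists c, c * k = n %[mod d].
Proof.
move=> kd; exists (chinese k d 0 n %/ k).
by rewrite divnK ?chinese_modr // /dvdn chinese_modl // mod0n.
Qed.

(** The range starts at 1 because rectangle coordinates are positive. Trading [d] for the congruent
    0 gives the standard residues, among which only [c %% d] counts. *)
Lemma sum_eq_mod_period (d c : nat) :
  0 < d -> \sum_(1 <= i < d.+1) (i == c %[mod d] : nat) = 1.
Proof.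
move=> d0; have -> : \sum_(1 <= i < d.+1) (i == c %[mod d] : nat) =
                     \sum_(0 <= i < d) (i == c %[mod d] : nat).
  rewrite big_nat_recr //= [RHS]big_ltn // addnC; congr (_ + _).
  by rewrite modnn mod0n.
rewrite big_mkord (bigD1 (Ordinal (ltn_pmod c d0))) //= modn_mod eqxx.
rewrite big1 // => i ne; rewrite (modn_small (ltn_ord i)).
by case: eqP => // E; case/eqP: ne; apply: val_inj.
Qed.

Lemma sum_eq_mod (d c q r : nat) : 0 < d ->
  \sum_(1 <= i < (q * d + r).+1) (i == c %[mod d] : nat) =
  q + \sum_(1 <= i < r.+1) (i == c %[mod d] : nat).
Proof.
move=> d0; elim: q => [|q IHq]; first by rewrite mul0n !add0n.
rewrite (@big_cat_nat _ _ _ d.+1) /=; [|by []|by rewrite mulSn -addnA ltnS leq_addr].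
rewrite sum_eq_mod_period // [q.+1 + _]addSn -IHq -[RHS]add1n; congr (1 + _).
rewrite -[X in \big[_/_]_(X <= _ < _) _]add1n big_addn.
rewrite mulSn -addnA -addnS addKn.
by apply: eq_bigr => i _; rewrite modnDr.
Qed.

(** * Gaps as points of a rectangle *)

Section RectangleCount.

Variables (a b d : nat).

Definition rect_cong : {set 'I_b * 'I_a} :=
  [set p : 'I_b * 'I_a | [&& 0 < p.1, 0 < p.2 & p.1 * a == p.2 * b %[mod d]]].

Definition rect_cong_pos : {set 'I_b * 'I_a} :=
  [set p in rect_cong | p.2 * b < p.1 * a].

(** For a gap [x], let [i < b] solve [i * a = d * x] modulo [b]. Then [d * x < i * a], as otherwise
    [d * x] would lie in [gen2 a b], and the difference is some [j * b]. Conversely,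
    [i * a - j * b = u * a + v * b] forces [u = i] modulo [b] with [u < i < b], which no natural [u]
    satisfies. *)
Lemma gap_quotientP : 0 < b -> 0 < d -> coprime a b ->
  (~` quotient_set (gen2 a b) d)%classic =
  [set n | exists2 p, p \in rect_cong_pos & n = (p.1 * a - p.2 * b) %/ d]%classic.
Proof.
move=> b0 d0 ab; apply/seteqP; split=> x /=.
  move=> gap; have [c cE] := modn_solve_coprime _ _ (d * x) ab.
  have lt_i := ltn_pmod c b0; pose i := Ordinal lt_i.
  have iE : i * a = d * x %[mod b] by rewrite /= modnMml.
  have lt_x : d * x < i * a.
    rewrite ltnNge; apply/negP => le; apply: gap.
    have /dvdnP[y Hy] : b %| d * x - i * a by rewrite -eqn_mod_dvd // iE.
    by exists i, y; rewrite -Hy subnKC.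
  have /dvdnP[y Hy] : b %| i * a - d * x.
    by rewrite -eqn_mod_dvd ?iE // ltnW.
  have lt_y : y < a.
    have : i * a < b * a by rewrite ltn_mul2r ltn_ord andbT; case: (a) lt_x => //; rewrite muln0.
    rewrite -[y < a](@ltn_pmul2r b) // -Hy [b * a]mulnC => H.
    exact: leq_ltn_trans (leq_subr _ _) H.
  exists (i, Ordinal lt_y) => /=.
    have dx0 : 0 < d * x.
      rewrite lt0n; apply/eqP => dx0; apply: gap.
      by exists 0, 0; rewrite dx0.
    rewrite !inE /= -!Hy; apply/andP; split.
      apply/and3P; split.
      - by rewrite lt0n; apply/eqP => i0; move: lt_x; rewrite /= i0.
      - rewrite lt0n; apply/eqP => y0; move: lt_x.
        by rewrite -subn_gt0 Hy y0.
      rewrite eqn_mod_dvd ?leq_subr // subKn ?dvdn_mulr //; exact: ltnW.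
    by rewrite ltn_subrL dx0 (leq_ltn_trans _ lt_x).
  by rewrite /= -Hy subKn ?mulKn //; exact: ltnW.
case=> -[i j]; rewrite !inE /= => /andP[/and3P[i0 j0 cong] lt_ji] xE [u [v]].
have dE : d * x = i * a - j * b.
  by rewrite xE mulnC divnK // -eqn_mod_dvd // ltnW.
move=> E; have {}E : i * a = u * a + (v + j) * b by rewrite mulnDl; lia.
have ui : u * a = i * a %[mod b] by rewrite E addnC modnMDl.
move/eqP: ui; rewrite eqn_modMr_coprime // (modn_small (ltn_ord i)) => /eqP ui.
have : u < i.
  rewrite ltnNge; apply/negP => le.
  have : i * a <= u * a by rewrite leq_mul2r le orbT.
  have : 0 < (v + j) * b by rewrite muln_gt0 b0 addn_gt0 j0 orbT.
  by lia.
by rewrite -ui ltnNge leq_mod.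
Qed.

(** The division by [d] is exact, and [i * a - j * b] determines [i] modulo [b], hence [i] and then
    [j], so distinct pairs give distinct gaps. *)
Lemma genus_quotient_card : 0 < b -> 0 < d -> coprime a b ->
  genus (quotient_set (gen2 a b) d) = #|rect_cong_pos|.
Proof.
move=> b0 d0 ab; rewrite /genus gap_quotientP // (@card_set_imset _ _ (fun p => _)) //.
move=> -[i j] [i' j']; rewrite !inE /= => /andP[/and3P[_ _ c] lt].
move=> /andP[/and3P[_ _ c'] lt'] E.
have {}E : i * a - j * b = i' * a - j' * b.
  rewrite -[LHS](@divnK d) -1?[RHS](@divnK d) ?E // -eqn_mod_dvd //; exact: ltnW.
have {}E : j' * b + i * a = j * b + i' * a by lia.
have : i * a == i' * a %[mod b] by rewrite -(modnMDl j') E modnMDl.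
rewrite eqn_modMr_coprime // !modn_small // => /eqP /val_inj ii.
subst i'; congr pair; apply: val_inj => /=; apply/eqP.
by rewrite -(eqn_pmul2r b0) -(eqn_add2r (i * a)) E.
Qed.

(* The central symmetry (i, j) -> (b - i, a - j) of the rectangle preserves the
   congruence and changes the sign of i a - j b, which never vanishes. *)
Lemma card_rect_cong : 0 < a -> 0 < b -> coprime a b ->
  #|rect_cong| = #|rect_cong_pos|.*2.
Proof.
move=> a0 b0 ab.
(* The reductions modulo [b] and [a] only serve to land in the ordinals; they change nothing when
   both coordinates are positive. *)
pose refl (p : 'I_b * 'I_a) : 'I_b * 'I_a :=
  (Ordinal (ltn_pmod (b - p.1) b0), Ordinal (ltn_pmod (a - p.2) a0)).
have reflE (p : 'I_b * 'I_a) : 0 < p.1 -> 0 < p.2 ->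
    ((refl p).1 = b - p.1 :> nat) * ((refl p).2 = a - p.2 :> nat).
  by move=> i0 j0 /=; rewrite !modn_small //; lia.
have lin (p : 'I_b * 'I_a) : 0 < p.1 -> 0 < p.2 ->
    (refl p).1 * a + p.1 * a = (refl p).2 * b + p.2 * b.
  move=> i0 j0; rewrite !reflE // -!mulnDl !subnK 1?mulnC //; exact: ltnW.
have reflP p : p \in rect_cong -> refl p \in rect_cong.
  rewrite !inE => /and3P[i0 j0 /eqP c]; have L := lin p i0 j0.
  rewrite !reflE // !subn_gt0 !ltn_ord /= -!reflE //.
  by rewrite -(eqn_modDr (p.1 * a)) L eqn_modDl; apply/eqP.
have reflK : {in rect_cong, involutive refl}.
  move=> p pR; have := reflP p pR; move: pR; rewrite !inE.
  move=> /and3P[i0 j0 _] /and3P[i1 j1 _].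
  rewrite [p]surjective_pairing [LHS]surjective_pairing.
  congr pair; apply: val_inj.
    by rewrite [LHS](reflE _ i1 j1).1 (reflE _ i0 j0).1 subKn // ltnW.
  by rewrite [LHS](reflE _ i1 j1).2 (reflE _ i0 j0).2 subKn // ltnW.
rewrite -addnn -[LHS](cardsID [set p : 'I_b * 'I_a | p.2 * b < p.1 * a]).
congr (_ + _); first by apply: eq_card => p; rewrite !inE.
rewrite -(@card_in_imset _ _ refl); last first.
  move=> p q; rewrite !inE => /andP[_ pR] /andP[_ qR] E.
  by rewrite -[p]reflK ?inE // E reflK ?inE.
apply: eq_card => p; apply/imsetP/idP.
  move=> [q]; rewrite finset.in_setD => /andP[lt qR] ->.
  rewrite inE reflP //=.
  have := qR; rewrite !inE in lt *; move=> /and3P[i0 j0 _].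
  have L := lin q i0 j0; have := lt; rewrite -leqNgt leq_eqVlt => /orP[/eqP E|lt']; last first.
    by rewrite -(ltn_add2r (q.2 * b)) -L ltn_add2l.
  (* Equality [q.1 * a = q.2 * b] would make [b] divide [q.1], although [0 < q.1 < b]. *)
  have : q.1 * a == 0 * a %[mod b] by rewrite mul0n mod0n E modnMl.
  by rewrite eqn_modMr_coprime // mod0n modn_small // eqn0Ngt i0.
rewrite inE => /andP[pR lt]; exists (refl p); last by rewrite reflK.
rewrite finset.in_setD reflP // andbT !inE -leqNgt.
by move: pR; rewrite inE => /and3P[i0 j0 _]; 
rewrite -(leq_add2r (p.1 * a)) lin // leq_add2l ltnW.
Qed.

(** * Counting the congruence over the rectangle *)

Lemma card_rect_cong_sum : 0 < a -> 0 < b ->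
  #|rect_cong| =
  \sum_(1 <= j < a) \sum_(1 <= i < b) (i * a == j * b %[mod d] : nat).
Proof.
move=> a0 b0; pose e i j : nat := [&& 0 < i, 0 < j & i * a == j * b %[mod d]].
have -> : #|rect_cong| = \sum_(0 <= j < a) \sum_(0 <= i < b) e i j.
  rewrite -sum1_card big_mkcond /= exchange_big_nat /= big_mkord.
  under [RHS]eq_bigr do rewrite big_mkord.
  by rewrite pair_big /=; apply: eq_bigr => p _; rewrite inE /e; case: ifP.
rewrite big_ltn // [X in X + _]big1 ?add0n; last by move=> i _; rewrite /e andbF.
apply: eq_big_nat => j /andP[j0 _]; rewrite big_ltn // add0n.
by apply: eq_big_nat => i /andP[i0 _]; rewrite /e i0 j0.
Qed.

(* With b = a M mod d, the congruence i a = j b reads i = j M.  Full periods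
   are peeled off first in i, then in j; a box of sides smaller than d remains. *)
Lemma card_rect_cong_count (M : nat) : 0 < a -> 0 < b -> 0 < d ->
  coprime a d -> coprime b d -> b = a * M %[mod d] ->
  #|rect_cong| + 1 =
  a.-1 * (b.-1 %/ d) + (b.-1 %% d) * (a.-1 %/ d) +
  \sum_(0 <= k < (a.-1 %% d).+1) (k * M %% d <= b.-1 %% d : nat).
Proof.
move=> a0 b0 d0 ad bd bE; rewrite card_rect_cong_sum //.
set q := _.-1 %/ d; set r := _.-1 %% d; set p := _.-1 %/ d; set s := _.-1 %% d.
have eE i j : (i * a == j * b %[mod d]) = (i == j * M %[mod d]).
  by rewrite -[RHS](eqn_modMr_coprime a) // -mulnA [M * a]mulnC -(modnMmr j b) bE modnMmr.
have aE : a = (p * d + s).+1 by rewrite -divn_eq prednK.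
have bE' : b = (q * d + r).+1 by rewrite -divn_eq prednK.
under eq_bigr => j _.
  rewrite {1}bE'; under eq_bigr do rewrite eE.
  rewrite sum_eq_mod //; over.
rewrite big_split /= sum_nat_const_nat subn1 -!addnA; congr (_ + _).
rewrite exchange_big_nat /=.
(* For each of the [r] remaining [i], invertibility of [b] modulo [d] turns the congruence into
   [j = c], so full periods in [j] split off; the form [i = j * M] is then restored. *)
under eq_bigr => i _.
  have [c cE] := modn_solve_coprime _ _ (i * a) bd.
  rewrite {1}aE; under eq_bigr => j _.
    rewrite -eE -cE eqn_modMr_coprime // eq_sym; over.
  rewrite sum_eq_mod //.
  under eq_bigr => j _.
    rewrite eq_sym -(eqn_modMr_coprime b) // cE eE; over.
  over.
rewrite big_split /= sum_nat_const_nat subn1 /= -addnA; congr (_ + _).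
(* The term [k = 0] always counts and accounts for the [+ 1] on the left. *)
rewrite exchange_big_nat /= [RHS]big_ltn // mul0n mod0n leq0n addnC; congr (_ + _).
apply: eq_big_nat => j /andP[j0 js].
have sd : s < d by rewrite ltn_pmod.
have rd : r < d by rewrite ltn_pmod.
(* The range of [i] omits 0, so the residue must be nonzero for the row to contain a solution
   exactly when [j * M %% d <= r]. *)
have jM : 0 < j * M %% d.
  rewrite lt0n; apply/negP => /eqP jM0.
  have := eE 0 j; rewrite mul0n jM0 mod0n eqxx => E.
  have : j * b == 0 * b %[mod d] by rewrite mul0n mod0n eq_sym E.
  rewrite eqn_modMr_coprime // mod0n modn_small; last exact: leq_trans js _.
  by rewrite eqn0Ngt j0.
have small i : i \in index_iota 1 r.+1 -> (i == j * M %[mod d]) = (i == j * M %% d).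
  by rewrite mem_index_iota => /andP[_ ir]; rewrite modn_small //; exact: leq_trans ir _.
rewrite (eq_big_seq (fun i => (i == j * M %% d : nat))); last first.
  by move=> i /small ->.
case: leqP => le.
  rewrite (bigD1_seq (j * M %% d)) ?iota_uniq ?mem_index_iota ?jM //= eqxx.
  by rewrite big1 // => i /negbTE ->.
rewrite big_nat big1 // => i /andP[_ ir].
by rewrite ltn_eqF //; exact: leq_trans ir le.
Qed.

End RectangleCount.

(** * Genus formulas in the naturals *)

Lemma genus_quotient_count (a b d M : nat) : 0 < a -> 0 < b -> 0 < d ->
  coprime a b -> coprime a d -> coprime b d -> b = a * M %[mod d] ->
  (genus (quotient_set (gen2 a b) d)).*2 + 1 =
  a.-1 * (b.-1 %/ d) + (b.-1 %% d) * (a.-1 %/ d) +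
  \sum_(0 <= k < (a.-1 %% d).+1) (k * M %% d <= b.-1 %% d : nat).
Proof.
move=> a0 b0 d0 ab ad bd bE.
by rewrite genus_quotient_card // -card_rect_cong // (card_rect_cong_count _ _ _ M).
Qed.

(** Sylvester's formula is the case [d = 1]: every congruence holds, so [M = 0] will do, and only
    [k = 0] remains in the sum. *)
Lemma genus_gen2 (a b : nat) : 0 < a -> 0 < b -> coprime a b ->
  (genus (gen2 a b)).*2 = a.-1 * b.-1.
Proof.
move=> a0 b0 ab.
have <- : quotient_set (gen2 a b) 1 = gen2 a b.
  by apply/seteqP; split => n; rewrite /quotient_set /= mul1n.
apply/eqP; rewrite -(eqn_add2r 1) (genus_quotient_count _ _ 1 0) ?coprimen1 ?modn1 //.
by rewrite big_nat1 divn1 mul0n addn0.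
Qed.

(** Only [k = 0] counts: either it is the whole range, or [r = 0] requires [d] to divide [k * M],
    hence [k], while [k <= s < d]. *)
Lemma count_eq1 (s M r d : nat) : s < d -> coprime M d -> s = 0 \/ r = 0 ->
  \sum_(0 <= k < s.+1) (k * M %% d <= r : nat) = 1.
Proof.
move=> sd Md sr; rewrite big_ltn // mul0n mod0n leq0n big_nat big1 ?addn0 //.
move=> k /andP[k0 ks]; case: sr => [s0|->]; first by move: ks; rewrite s0; case: k k0.
rewrite leqn0; case: eqP => // kM.
have : k * M == 0 * M %[mod d] by rewrite kM mul0n mod0n.
rewrite eqn_modMr_coprime // mod0n modn_small; last exact: leq_trans ks _.
by rewrite eqn0Ngt k0.
Qed.

(** * Fractional parts and the rational formula *)

Local Open Scope ring_scope.

Lemma frac_part_divz (z : int) (d : nat) : (0 < d)%N ->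
  frac_part (z%:~R / d%:R) = (z %% d)%Z%:~R / d%:R.
Proof.
move=> d0; have d0' : (0 : rat) < d%:R by rewrite ltr0n.
have zE : (z%:~R : rat) = (z %/ d)%Z%:~R * d%:R + (z %% d)%Z%:~R.
  by rewrite {1}(divz_eq z d) rmorphD rmorphM.
have r0 : (0 : rat) <= (z %% d)%Z%:~R by rewrite ler0z modz_ge0 // -lt0n.
have rd : (z %% d)%Z%:~R < d%:R :> rat.
  by rewrite -[d%:R]/(d%:Z%:~R) ltr_int ltz_pmod.
rewrite /frac_part (@floor_def _ _ (z %/ d)%Z).
  by rewrite zE; field; rewrite lt0r_neq0.
by rewrite ler_pdivlMr // ltr_pdivrMr // rmorphD zE mulrDl mul1r lerDl r0 ltrD2l.
Qed.

Lemma frac_part_predn (n d : nat) : (0 < n)%N -> (0 < d)%N ->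
  frac_part ((n%:R - 1) / d%:R) = (n.-1 %% d)%N%:R / d%:R.
Proof.
move=> n0 d0; rewrite -{1}(prednK n0) -natr1 addrK.
by rewrite -[n.-1%:R]/(n.-1%:Z%:~R) frac_part_divz // modz_nat.
Qed.

Lemma countC_sum (d M r s : nat) : (0 < d)%N ->
  countC (M%:R / d%:R) (r%:R / d%:R) s%:R =
  (\sum_(0 <= k < s.+1) (k * M %% d <= r : nat))%N.
Proof.
move=> d0; have d0' : (0 : rat) < d%:R by rewrite ltr0n.
have -> : (\sum_(0 <= k < s.+1) (k * M %% d <= r : nat))%N =
          #|[set k : 'I_s.+1 | (k * M %% d <= r)%N]|.
  rewrite -sum1_card [RHS]big_mkcond big_mkord.
  by apply: eq_bigr => k _; rewrite inE; case: ifP.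
rewrite /countC -(@card_set_imset _ _ val); last by move=> x y _ _; exact: val_inj.
congr card_set; apply/seteqP; split=> k /=; rewrite mulrA -natrM.
  rewrite -[(k * M)%:R]/((k * M)%N%:Z%:~R) frac_part_divz // modz_nat.
  rewrite ler_nat ler_pM2r ?invr_gt0 // ler_nat => -[ks kr].
  by exists (Ordinal (ks : (k < s.+1)%N)); rewrite ?inE.
rewrite -[(k * M)%:R]/((k * M)%N%:Z%:~R) frac_part_divz // modz_nat.
rewrite ler_nat ler_pM2r ?invr_gt0 // ler_nat => -[[i lti]].
by rewrite inE /= => le ->.
Qed.

Theorem theorem10 (a b d : nat) (m : int)
  (ha : (0 < a)%N) (hb : (0 < b)%N) (hd : (0 < d)%N)
  (hab : coprime a b) (had : coprime a d) (hbd : coprime b d)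
  (hm : (b%:Z = a%:Z * m %[mod d%:Z])%Z) :
  let alpha : rat := frac_part (m%:~R / d%:R) in
  let beta : rat := frac_part ((b%:R - 1) / d%:R) in
  let nu : rat := d%:R * frac_part ((a%:R - 1) / d%:R) in
  let S := gen2 a b in
  ((genus (quotient_set S d))%:R : rat) =
    (genus S)%:R / d%:R + 2^-1 * ((countC alpha beta nu)%:R - 1 - beta * nu)
  /\
  ((a = 1 %[mod d])%N \/ (b = 1 %[mod d])%N ->
   ((genus (quotient_set S d))%:R : rat) = (genus S)%:R / d%:R /\
   ((genus S)%:R : rat) / d%:R
     = (a%:R - 1) * (b%:R - 1) / (2 * d%:R)).
Proof.
move=> alpha beta nu S.
have dN0 : (d%:R : rat) != 0 by rewrite pnatr_eq0 -lt0n.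
(* [M] is the natural representative of [m] modulo [d], so [alpha] becomes [M / d]. *)
have [M ME] : exists M : nat, (m %% d)%Z = M%:Z.
  by exists `|(m %% d)%Z|%N; rewrite gez0_abs // modz_ge0 // -lt0n.
have bE : (b = a * M %[mod d])%N.
  by apply/eqP; rewrite -eqz_nat -!modz_nat hm PoszM -ME modzMmr.
have Md : coprime M d.
  have : coprime (b %% d)%N d by rewrite coprime_modl.
  by rewrite bE coprime_modl coprimeMl => /andP[].
set r := (b.-1 %% d)%N; set s := (a.-1 %% d)%N.
have alphaE : alpha = M%:R / d%:R by rewrite /alpha frac_part_divz // ME.
have betaE : beta = r%:R / d%:R by rewrite /beta frac_part_predn.
have nuE : nu = s%:R by rewrite /nu frac_part_predn // mulrC divfK.
have aE : a%:R - 1 = (a.-1)%:R :> rat by rewrite -{1}(prednK ha) -natr1 addrK.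
have bE' : b%:R - 1 = (b.-1)%:R :> rat by rewrite -{1}(prednK hb) -natr1 addrK.
have gS : (genus S)%:R = (a%:R - 1) * (b%:R - 1) / 2 :> rat.
  by rewrite aE bE' -natrM -genus_gen2 // -muln2 natrM mulfK.
have main : (genus (quotient_set S d))%:R =
    (genus S)%:R / d%:R + 2^-1 * ((countC alpha beta nu)%:R - 1 - beta * nu).
  have /(congr1 (fun n => n%:R : rat)) :=
    genus_quotient_count a b d M ha hb hd hab had hbd bE.
  rewrite alphaE betaE nuE countC_sum // -/r -/s gS aE bE'.
  (* With [a - 1 = p * d + s] and [b - 1 = q * d + r], one has [(a - 1) * (b - 1) = d * ((a - 1) * q
     + r * p) + r * s]; the correction [r * s / d] is [beta * nu]. *)
  rewrite [in X in _ -> X](divn_eq b.-1 d) -/r.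
  rewrite -muln2 !(natrD, natrM) -/S.
  have -> : a.-1%:R = (a.-1 %/ d)%N%:R * d%:R + s%:R :> rat.
    by rewrite -natrM -natrD -divn_eq.
  set g := (genus _)%:R => E.
  have -> : g = (g * 2 + 1 - 1) / 2 by field.
  by rewrite E; field.
split=> // one; split; last by rewrite gS; field.
(* The extra hypothesis makes [nu] or [beta] vanish; then the count is 1 and the bracket is zero. *)
have sr : s = 0%N \/ r = 0%N.
  by case: one => /eqP one; [left | right]; apply/eqP; move: one;
    rewrite eqn_mod_dvd // subn1.
rewrite main alphaE betaE nuE countC_sum // count_eq1 ?ltn_pmod //.
by case: sr => ->; rewrite subrr ?(mulr0, mul0r, subr0, addr0).
Qed.
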